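(* $\widehat{\mathsf{\Delta}}=\min\{|\mathcal A|:\mathcal A\subseteq[\omega]^\omega\ \wedge\ \forall E\in\mathbb E_\omega\ \exists A\in\mathcal A\ (A\text{ is }\{E\}\text{-discrete})\}$.
   Context: $[\omega]^\omega$ is the family of all infinite subsets of $\omega$. $I_\omega$ is the set of all involutions $h:\omega\to\omega$ (i.e. $h\circ h=\mathrm{id}$) having at most one fixed point, and $$\widehat{\mathsf{\Delta}}=\min\{|\mathcal A|:\mathcal A\subseteq[\omega]^\omega\ \wedge\ \forall h\in I_\omega\ \exists A\in\mathcal A\ \ |h[A]\cap A|<\omega\}.$$ An entourage on $\omega$ is a set $E\subseteq\omega\times\omega$ containing the diagonal; $E(x)=\{y:(x,y)\in E\}$ and $E^{-1}(x)=\{y:(y,x)\in E\}$. $\mathbb E_\omega$ is the family of finitary entourages on $\omega$, i.e. those with $\sup_{x\in\omega}|E(x)\cup E^{-1}(x)|<\omega$. A set $A\subseteq\omega$ is $\{E\}$-discrete if the set $\{x\in A:A\cap E(x)\ne\{x\}\}$ is finite. *)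

(* Defs.v *)
From mathcomp Require Import all_boot.
From mathcomp Require Import all_classical.

Set Implicit Arguments.
Unset Strict Implicit.
Unset Printing Implicit Defensive.

Local Open Scope classical_set_scope.
Local Open Scope card_scope.

(* [min_card Phi] is the cardinal min {|A| : A in Phi}.  The library has no
   type of cardinals, so a cardinal is represented by an equinumerosity class
   of subsets of T: |A| = |B| is then an equality of classes, and [min_card Phi]
   is the class of a member of Phi of least cardinality.  It would be empty if
   the minimum did not exist, but [min_card_nonempty] shows that it does as
   soon as Phi is nonempty. *)
Definition min_card (T : Type) (Phi : set (set T)) : set (set T) :=
  [set B | exists A, [/\ Phi A, forall A', Phi A' -> A #<= A' & B #= A]].

(* The proof takes a maximal set of choice functions on Phi that pairwise
   differ at every argument; it must exhaust some member of Phi, and thereby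
   injects that member into all the others. *)
Lemma min_card_nonempty (T : Type) (Phi : set (set T)) :
  Phi !=set0 -> min_card Phi !=set0.
Proof.
move=> [A0 PA0].
suff [A [PA minA]] : exists A, Phi A /\ forall A', Phi A' -> A #<= A'.
  by exists A; exists A; split => //; exact: card_eqxx.
pose P (S : set (set T -> T)) :=
  (forall f, S f -> forall A, Phi A -> A (f A)) /\
  (forall f g, S f -> S g -> forall A, Phi A -> f A = g A -> f = g).
have [|S [[Sin Sinj] Smax]] := @Zorn_bigcup _ P.
  move=> F FP Ftot; split.
    by move=> f [S FS Sf] A PA; exact: (FP _ FS).1 f Sf A PA.
  move=> f g [S FS Sf] [S' FS' S'g] A PA.
  have [SS'|S'S] := Ftot _ _ FS FS'.
    by exact: (FP _ FS').2 f g (SS' _ Sf) S'g A PA.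
  by exact: (FP _ FS).2 f g Sf (S'S _ S'g) A PA.
have [A [PA AS]] : exists A, Phi A /\ forall a, A a -> exists2 f, S f & f A = a.
  apply: contrapT => noA.
  have missed A : exists a,
      Phi A -> A a /\ forall f, S f -> f A <> a.
    have [PA|nPA] := pselect (Phi A).
      apply: contrapT => nex; apply: noA; exists A; split=> // a Aa.
      apply: contrapT => nf; apply: nex; exists a => _; split=> // f Sf fAa.
      by apply: nf; exists f.
    have [a] : [set: T] !=set0.
      apply: contrapT => T0; apply: noA; exists A0; split => // a.
      by case: T0; exists a.
    by exists a.
  have {missed} [g Pg] := choice missed.
  have /Smax : S `<` S `|` [set g].
    rewrite properEneq; split; last by move=> ? ?; left.
    apply/eqP => SE; have : S g by rewrite SE; right.
    by move=> Sg; have [_ /(_ _ Sg)] := Pg _ PA0; exact.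
  apply; split => [f [Sf|->] A PA|f f' [Sf|->] [Sf'|->] A PA //].
  - exact: (Sin f Sf A PA).
  - by have [] := Pg _ PA.
  - exact: (Sinj f f' Sf Sf' A PA).
  - by have [_ /(_ _ Sf)] := Pg _ PA.
  - by move=> /esym; have [_ /(_ _ Sf')] := Pg _ PA.
exists A; split => // B PB.
have /choice[F FP] : forall a, exists f, A a -> S f /\ f A = a.
  move=> a; have [Aa|nAa] := pselect (A a); last by exists (fun=> a).
  by have [f Sf fa] := AS _ Aa; exists f.

have Finj : {in A &, injective (fun a => F a B)}.
  move=> a b /set_mem Aa /set_mem Ab FE.
  have [Sa <-] := FP _ Aa; have [Sb <-] := FP _ Ab.
  by rewrite (Sinj _ _ Sa Sb _ PB FE).
rewrite -(card_le_eql (inj_card_eq Finj)).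
by apply: subset_card_le => _ [a Aa <-]; have [Sa _] := FP _ Aa; exact: (Sin _ Sa B PB).
Qed.

Definition infinite_subsets : set (set nat) := [set A | infinite_set A].

Definition I_omega : set (nat -> nat) :=
  [set h | involutive h /\ forall x y, h x = x -> h y = y -> x = y].

Definition Delta_hat : set (set (set nat)) :=
  min_card [set F : set (set nat) |
    F `<=` infinite_subsets /\
    forall h, I_omega h -> exists2 A, F A & finite_set (h @` A `&` A)].

Definition is_entourage (E : set (nat * nat)) : Prop := diagonal `<=` E.

(* E(x) is [xsection E x] and E^{-1}(x) is [ysection E x]. *)
Definition E_omega : set (set (nat * nat)) :=
  [set E | is_entourage E /\
    exists n : nat, forall x, xsection E x `|` ysection E x #<= `I_n].

Definition is_discrete (E : set (nat * nat)) (A : set nat) : Prop :=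
  finite_set [set x | A x /\ A `&` xsection E x <> [set x]].

Lemma Delta_hat_nonempty : Delta_hat !=set0.
Proof.
apply: min_card_nonempty; exists infinite_subsets; split => // h [hK hfix].
exists [set n | n < h n]; last first.
  rewrite (_ : _ `&` _ = set0); first exact: finite_set0.
  apply/seteqP; split => // _ [[n /= nhn <-]] /=.
  by rewrite hK => /(ltn_trans nhn); rewrite ltnn.
move=> /= Afin.
have Bfin := finite_image h Afin.
have Ffin : finite_set [set n | h n = n].
  have [[x hx]|nofix] := pselect (exists x, h x = x).
    by apply: (@sub_finite_set _ _ [set x]); [move=> y /= hy; exact: hfix|exact: finite_set1].
  by apply: (@sub_finite_set _ _ set0); [move=> y /= hy; case: nofix; exists y|exact: finite_set0].
have /infiniteP : [set: nat] #<= [set: nat] by exact: card_lexx.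
apply; apply: (@sub_finite_set _ _
  ([set n | n < h n] `|` h @` [set n | n < h n] `|` [set n | h n = n])).
  move=> n _; have [nh|hn|/esym hn] := ltngtP n (h n).
  - by left; left.
  - by left; right; exists (h n); rewrite /= hK.
  - by right.
by rewrite !finite_setU.
Qed.

(* Main.v *)
Require Import Defs.
From mathcomp Require Import all_boot.
From mathcomp Require Import all_classical.
Local Open Scope classical_set_scope.
Local Open Scope card_scope.

(** Discreteness of [A] for the entourage formed by the diagonal and the graph of
    an involution [h] says that [h @` A `&` A] is finite, since [h] has at most
    one fixed point.  So a family that is discrete for every
    finitary entourage handles every involution
    ([discrete_involution_family]), and it remains to turn a family [F] that
    handles every involution into one, of no larger cardinality, that is
    discrete for every finitary entourage ([involution_family_refines]).

    A finitary entourage is a graph of bounded degree on [nat], hence a finite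
    union of matchings ([entourage_matchings]).  A matching extends to an
    involution with at most one fixed point
    ([matching_extends_to_involution]), so some member of [F] contains only
    finitely many points matched within it.  Several matchings are handled one
    after the other: if [A1] in [F] handles the first matching, enumerate a part
    of [A1] by an injection of [nat], pull the second matching back along it, and
    choose [A2] in [F] for the result; the image of [A2] in [A1] handles both
    matchings, and so on ([refinement_matchings]).  The sets obtained in this way
    are indexed by the finite sequences of members of [F].

    There are no more of these sequences than members of [F], because [F] is
    infinite: countably many infinite sets are all met infinitely often by the
    edges of one matching ([matching_meeting_countably_many]), and an infinite
    set has as many finite sequences as elements ([infinite_seq_card_le]), by
    Hessenberg's theorem on squares ([infinite_pairing]). *)

(** * Injections and maximal sets *)

Definition inj_into {T U : Type} (A : set T) (B : set U) (f : T -> U) : Prop :=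
  (forall a, A a -> B (f a)) /\
  (forall a a', A a -> A a' -> f a = f a' -> a = a').

Lemma card_le_inj_into {T U : Type} {A : set T} {B : set U} (u : U) :
  A #<= B -> exists f, inj_into A B f.
Proof.
elim/Ppointed: U => U in B u *; first by case: (no u).
move=> /pcard_leP[f]; exists f; split; first exact: 'funS_f.
by move=> a a' Aa Aa'; apply: ('inj_f); rewrite inE.
Qed.

Lemma inj_into_card_le {T U : Type} {A : set T} {B : set U} {f : T -> U} :
  inj_into A B f -> A #<= B.
Proof.
move=> [fAB finj].
have finj' : {in A &, injective f} by move=> a a' /set_mem Aa /set_mem; exact: finj.
rewrite -(card_le_eql (inj_card_eq finj')).
by apply: subset_card_le => _ [a Aa <-]; exact: fAB.
Qed.

Lemma card_comparable {T : Type} (A B : set T) : A #<= B \/ B #<= A.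
Proof.
have [|_ [M [[->|->] minM _]]] := @min_card_nonempty T [set X | X = A \/ X = B].
- by exists A; left.
- by left; apply: minM; right.
- by right; apply: minM; left.
Qed.

(** The chain hypothesis concerns nonempty chains only, so the base set [S0]
    supplies what a union over the empty chain would lack. *)
Lemma Zorn_above {T : Type} (P : set (set T)) (S0 : set T) : P S0 ->
  (forall F, F !=set0 -> F `<=` P -> total_on F subset ->
     P (\bigcup_(X in F) X)) ->
  exists S, [/\ S0 `<=` S, P S & forall S', S `<=` S' -> P S' -> S' `<=` S].
Proof.
move=> PS0 Pchain.
have [|S [PS Smax]] := @Zorn_bigcup T [set X | P (X `|` S0)].
  move=> F FP Ftot /=.
  have [[X0 FX0]|F0] := pselect (F !=set0); last first.
    suff -> : \bigcup_(X in F) X `|` S0 = S0 by [].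
    by rewrite setUidr // => t [X FX _]; case: F0; exists X.
  have -> : \bigcup_(X in F) X `|` S0 =
            \bigcup_(Y in [set X `|` S0 | X in F]) Y.
    apply/seteqP; split=> [t [[X FX Xt]|S0t]|t [_ [X FX <-] [Xt|S0t]]].
    - by exists (X `|` S0); [exists X|left].
    - by exists (X0 `|` S0); [exists X0|right].
    - by left; exists X.
    - by right.
  apply: Pchain.
  - by exists (X0 `|` S0); exists X0.
  - by move=> _ [X FX <-]; exact: FP.
  - move=> _ _ [X FX <-] [Y FY <-].
    by have [XY|YX] := Ftot _ _ FX FY; [left|right]; exact: setSU.
exists (S `|` S0); split=> //.
move=> S' SS' PS' t S't; apply: contrapT => nt.
apply: (Smax S').
  split; last by move=> /(_ _ S't) St; apply: nt; left.
  by move=> x Sx; apply: SS'; left.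
rewrite /= setUidl // => x S0x; apply: SS'; right=> //.
Qed.

Lemma chain_pair {T : Type} {F : set (set T)} {x y : T} :
  total_on F subset -> (\bigcup_(X in F) X) x -> (\bigcup_(X in F) X) y ->
  exists X, [/\ F X, X x & X y].
Proof.
move=> Ftot [X FX Xx] [Y FY Yy].
have [XY|YX] := Ftot _ _ FX FY; first by exists Y; split=> //; exact: XY.
by exists X; split=> //; exact: YX.
Qed.

(** * Squares and finite sequences over an infinite set *)

Definition pairing_on {T : Type} (B : set T) (g : T -> T -> T) : Prop :=
  (forall a b, B a -> B b -> B (g a b)) /\
  (forall a b a' b', B a -> B b -> B a' -> B b' ->
     g a b = g a' b' -> a = a' /\ b = b').

(** A pairing makes room for a second copy of [B]: two distinct elements of
    [B], paired with the points of the two copies, keep them apart. *)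
Lemma pairing_absorbs {T : Type} {B C : set T} {g j} {t0 t1 : T} :
  pairing_on B g -> B t0 -> B t1 -> t0 <> t1 -> inj_into C B j ->
  exists s, inj_into (B `|` C) B s.
Proof.
move=> [gB ginj] Bt0 Bt1 t01 [jB jinj].
pose s x := if pselect (B x) then g t0 x else g t1 (j x).
exists s; split=> [x|x y]; rewrite /s.
  case: pselect => [Bx _|nBx [//|Cx]]; first exact: gB.
  by apply: gB => //; exact: jB.
case: pselect => Bx; case: pselect => By.
- by move=> _ _ /ginj[].
- move=> _ [//|/jB ?] /ginj[] // /t01 //.
- move=> [//|/jB ?] _ /ginj[] // /esym/t01 //.
- move=> [//|Cx] [//|Cy] /ginj[]; auto.
Qed.

(** Hessenberg's theorem.  A pairing is encoded by its graph, a set of triples,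
    so that Zorn's lemma for inclusion gives a maximal pairing extending one on
    a countable set.  Let [B] be its domain.  If the complement of [B] injects
    into [B], then so does [A], and the pairing is pulled back to [A].
    Otherwise the complement contains a copy [C] of [B], into which all the new
    pairs of points of [B `|` C] fit, so that the pairing was not maximal. *)
Lemma infinite_pairing {T : Type} {A : set T} :
  infinite_set A -> exists g, pairing_on A g.
Proof.
move=> Ainf; have [t _] := infinite_setN0 Ainf.
have [i [iA iinj]] := card_le_inj_into t (iffLR (infiniteP A) Ainf).
pose dom (R : set (T * T * T)) : set T := [set a | exists c, R (a, a, c)].
pose good (R : set (T * T * T)) :=
  [/\ dom R `<=` A,
      forall a b c, R (a, b, c) -> [/\ dom R a, dom R b & dom R c],
      forall a b, dom R a -> dom R b -> exists c, R (a, b, c),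
      forall a b c c', R (a, b, c) -> R (a, b, c') -> c = c' &
      forall a b a' b' c, R (a, b, c) -> R (a', b', c) -> a = a' /\ b = b'].
pose R0 : set (T * T * T) :=
  [set p | exists m n, p = (i m, i n, i (choice.pickle (m, n)))].
have domR0 n : dom R0 (i n) by exists (i (choice.pickle (n, n))), n, n.
have iE m n : i m = i n -> m = n by exact: iinj.
have gR0 : good R0.
  split.
  - by move=> _ [c [m [n [-> _ _]]]]; exact: iA.
  - by move=> _ _ _ [m [n [-> -> ->]]].
  - move=> _ _ [_ [m [_ [-> _ _]]]] [_ [n [_ [-> _ _]]]].
    by exists (i (choice.pickle (m, n))), m, n.
  - by move=> _ _ _ _ [m [n [-> -> ->]]] [m' [n' [/iE -> /iE -> ->]]].
  - move=> _ _ _ _ _ [m [n [-> -> ->]]] [m' [n' [-> ->]]] /iE.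
    by move=> /(pcan_inj choice.pickleK)[-> ->].
have [|R [R0R [RA Rdom Rtot Rfun Rinj] Rmax]] := @Zorn_above _ good R0 gR0.
  move=> F _ Fgood Ftot.
  have domU X : F X -> dom X `<=` dom (\bigcup_(X in F) X).
    by move=> FX a [c Xc]; exists c, X.
  split.
  - by move=> a [c [X FX Xc]]; have [XA _ _ _ _] := Fgood _ FX; apply: XA; exists c.
  - move=> a b c [X FX Xabc]; have [_ Xd _ _ _] := Fgood _ FX.
    by have [? ? ?] := Xd _ _ _ Xabc; split; exact: (domU X).
  - move=> a b [c ac] [d bd]; have [X [FX Xa Xb]] := chain_pair Ftot ac bd.
    have [_ _ Xt _ _] := Fgood _ FX.
    by have [|| e Xe] := Xt a b; [exists c|exists d|exists e, X].
  - move=> a b c c' h h'; have [X [FX Xh Xh']] := chain_pair Ftot h h'.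
    by have [_ _ _ Xf _] := Fgood _ FX; exact: Xf Xh Xh'.
  - move=> a b a' b' c h h'; have [X [FX Xh Xh']] := chain_pair Ftot h h'.
    by have [_ _ _ _ Xi] := Fgood _ FX; exact: Xi Xh Xh'.
set B := dom R in RA Rdom Rtot.
have iB n : B (i n) by have [c R0c] := domR0 n; exists c; exact: R0R.
have i01 : i 0 <> i 1 by move=> /iE.
have /choice[g gR] : forall a, exists f, forall b, B a -> B b -> R (a, b, f b).
  move=> a.
  suff /choice[h hP] : forall b, exists c, B a -> B b -> R (a, b, c) by exists h.
  move=> b.
  have [[Ba Bb]|nB] := pselect (B a /\ B b); last first.
    by exists t => Ba Bb; case: nB.
  by have [c ?] := Rtot _ _ Ba Bb; exists c.
have gB : pairing_on B g.
  split=> [a b Ba Bb|a b a' b' Ba Bb Ba' Bb' gE].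
    by have [] := Rdom _ _ _ (gR a b Ba Bb).
  by apply: (Rinj _ _ _ _ (g a b)); [|rewrite gE]; exact: gR.
have [AB|BA] := card_comparable (A `\` B) B.
  have [j jinj] := card_le_inj_into t AB.
  have [s [sB sinj]] := pairing_absorbs gB (iB 0) (iB 1) i01 jinj.
  have Asub a : A a -> (B `|` A `\` B) a.
    by move=> Aa; have [Ba|nBa] := pselect (B a); [left|right].
  case: gB => gBB ginj.
  exists (fun a b => g (s a) (s b)); split=> [a b /Asub/sB Ba /Asub/sB Bb|].
    by apply: RA; exact: gBB.
  move=> a b a' b' /Asub Aa /Asub Ab /Asub Aa' /Asub Ab'.
  by move=> /ginj[||||/sinj -> // /sinj ->] //; exact: sB.
exfalso.
(* [C] is a copy of [B] outside [B]; the values at the new pairs are taken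
   in [C], so that they differ from all the old ones. *)
have [f [fB finj]] := card_le_inj_into t BA.
pose C := f @` B.
have [j jP] : exists j, forall x, C x -> B (j x) /\ f (j x) = x.
  suff /choice[j jP] : forall x, exists y, C x -> B y /\ f y = x by exists j.
  move=> x; have [[y By fy]|nC] := pselect (C x); first by exists y.
  by exists t.
have jinj : inj_into C B j.
  split=> [x /jP[]//|x y /jP[_ xE] /jP[_ yE] jxy].
  by rewrite -xE -yE jxy.
have [s [sB sinj]] := pairing_absorbs gB (iB 0) (iB 1) i01 jinj.
have nBf x : B x -> ~ B (f x) by move=> /fB[].
pose D := B `|` C.
pose new : set (T * T * T) := [set p | exists x y,
  [/\ D x, D y, ~ (B x /\ B y) & p = (x, y, f (g (s x) (s y)))]].
have domE a : dom (R `|` new) a <-> D a.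
  split=> [[c [Rc|[x [y [Dx Dy _ [-> _ _]]]]]]|Da] //; first by left; exists c.
  have [[c Rc]|nBa] := pselect (B a); first by exists c; left.
  by exists (f (g (s a) (s a))); right; exists a, a; split=> // -[].
have gs x y : D x -> D y -> B (g (s x) (s y)).
  by move=> Dx Dy; apply: gB.1; exact: sB.
suff /(Rmax _ (@subsetUl _ _ _)) newR : good (R `|` new).
  have Cf : C (f (i 0)) by exists (i 0).
  have /newR/Rdom[/(nBf _ (iB 0))//] :
      (R `|` new) (f (i 0), f (i 0), f (g (s (f (i 0))) (s (f (i 0))))) by
    right; exists (f (i 0)), (f (i 0)); split=> //;
      [by right|by right|by case=> /(nBf _ (iB 0))].
split.
- move=> a /domE[/RA//|[b Bb <-]]; exact: (fB _ Bb).1.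
- move=> a b c [/Rdom[? ? ?]|[x [y [Dx Dy _ [-> -> ->]]]]].
    by split; apply/domE; left.
  split; apply/domE => //; right; exists (g (s x) (s y)) => //.
  exact: gs.
- move=> a b /domE Da /domE Db.
  have [[Ba Bb]|nB] := pselect (B a /\ B b).
    by have [c ?] := Rtot _ _ Ba Bb; exists c; left.
  by exists (f (g (s a) (s b))); right; exists a, b.
- move=> a b c c' [h|[x [y [_ _ nB [-> -> ->]]]]] [h'|[x' [y' [_ _ nB' [xE yE ->]]]]].
  + exact: Rfun h h'.
  + by case: nB'; rewrite -xE -yE; case: (Rdom _ _ _ h).
  + by case: nB; case: (Rdom _ _ _ h').
  + by rewrite xE yE.
- move=> a b a' b' c [h|[x [y [Dx Dy nB [-> -> ->]]]]]
    [h'|[x' [y' [Dx' Dy' nB' [xE yE cE]]]]].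
  + exact: Rinj h h'.
  + by have [_ _] := Rdom _ _ _ h; rewrite cE => /(nBf _ (gs _ _ Dx' Dy')).
  + by have [_ _ /(nBf _ (gs _ _ Dx Dy))] := Rdom _ _ _ h'.
  + rewrite xE yE; move: cE => /finj.
    case/(_ (gs _ _ Dx Dy) (gs _ _ Dx' Dy'))/gB.2; try exact: sB.
    by move=> /sinj -> // /sinj ->.
Qed.

(** A sequence is coded by its length paired with its iterated pairing; the
    length tells where to stop decoding. *)
Lemma infinite_seq_card_le {T : eqType} {A : set T} : infinite_set A ->
  [set s : seq T | forall x, x \in s -> A x] #<= A.
Proof.
move=> Ainf; have [t At] := infinite_setN0 Ainf.
have [i [iA iinj]] := card_le_inj_into t (iffLR (infiniteP A) Ainf).
have [g [gA ginj]] := infinite_pairing Ainf.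
pose code := foldr g t.
have codeA s : (forall x, x \in s -> A x) -> A (code s).
  elim: s => [//|x s IHs] sA /=; apply: gA; first exact/sA/mem_head.
  by apply: IHs => y ys; apply: sA; rewrite inE ys orbT.
apply: (@inj_into_card_le _ _ _ _ (fun s => g (i (size s)) (code s))); split.
  by move=> s sA; apply: gA; [exact: iA|exact: codeA].
move=> s s' sA s'A /ginj[||||/iinj ss'] //; try exact: iA; try exact: codeA.
have {ss'} : size s = size s' by exact: ss'.
elim: s s' sA s'A => [|x s IHs] [|x' s'] //= sA s'A [/IHs{}IHs].
have tlA y : y \in s -> A y by move=> ys; apply: sA; rewrite inE ys orbT.
have tlA' y : y \in s' -> A y by move=> ys; apply: s'A; rewrite inE ys orbT.
move=> /ginj[||||-> /IHs -> //];
  by [exact/sA/mem_head|exact: codeA|exact/s'A/mem_head|].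
Qed.

(** * Matchings *)

Definition matching {T : Type} (M : set (T * T)) : Prop :=
  [/\ forall x y, M (x, y) -> M (y, x),
      forall x, ~ M (x, x) &
      forall x y y', M (x, y) -> M (x, y') -> y = y'].

(** In a maximal matching no two distinct points are both unmatched, since
    they could be matched with each other. *)
Lemma matching_extends_to_involution {M : set (nat * nat)} : matching M ->
  exists h, I_omega h /\ forall x y, M (x, y) -> h x = y.
Proof.
move=> Mmatch.
have [|N [MN [Nsym Nirr Nfun] Nmax]] := @Zorn_above _ matching M Mmatch.
  move=> F _ Fm Ftot; split.
  - by move=> x y [X FX Xxy]; have [Xsym _ _] := Fm _ FX; exists X => //; exact: Xsym.
  - by move=> x [X FX]; have [_ Xirr _] := Fm _ FX; exact: Xirr.
  - move=> x y y' xy xy'; have [X [FX Xy Xy']] := chain_pair Ftot xy xy'.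
    by have [_ _ Xfun] := Fm _ FX; exact: Xfun Xy Xy'.
have /choice[h hP] : forall x, exists y,
    N (x, y) \/ (forall z, ~ N (x, z)) /\ y = x.
  move=> x; have [[y Nxy]|nN] := pselect (exists y, N (x, y)).
    by exists y; left.
  by exists x; right; split=> // z Nxz; apply: nN; exists z.
have hE x y : N (x, y) -> h x = y.
  by case: (hP x) => [Nx /(Nfun _ _ _ Nx)|[nN _] /nN].
exists h; split=> [|x y /MN/hE//].
split=> [x|x y hx hy].
  case: (hP x) => [/Nsym/hE //|[nN hx]]; by rewrite hx.
have un z : h z = z -> forall w, ~ N (z, w).
  by case: (hP z) => [|[]//]; move=> + hz; rewrite hz => /Nirr.
apply: contrapT => xy.
have /(Nmax _ (@subsetUl _ _ _)) : matching (N `|` [set p | p = (x, y) \/ p = (y, x)]).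
  have ux := un _ hx; have uy := un _ hy; split.
  - move=> a b [/Nsym|[[-> ->]|[-> ->]]]; by [left|right; right|right; left].
  - by move=> a [/Nirr//|[[-> /xy]|[-> /esym/xy]]].
  - move=> a b b' [Nab|[[aE ->]|[aE ->]]] [Nab'|[[aE' ->]|[aE' ->]]] //.
    + exact: Nfun Nab Nab'.
    + by move: Nab; rewrite aE' => /ux.
    + by move: Nab; rewrite aE' => /uy.
    + by move: Nab'; rewrite aE => /ux.
    + by case: xy; rewrite -aE -aE'.
    + by move: Nab'; rewrite aE => /uy.
    + by case: xy; rewrite -aE -aE'.
by move=> /(_ (x, y)) Nxy; apply: (un _ hx y); apply: Nxy; right; left.
Qed.

(** Consider a maximal partial proper colouring with one colour more than there
    are labels.  The labels bound the number of neighbours of a vertex, so an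
    uncoloured vertex would have a free colour. *)
Lemma bounded_degree_coloring {T : Type} {L : finType} (H : T -> T -> Prop)
    (lab : T -> T -> L) :
  (forall x y, H x y -> H y x) -> (forall x, ~ H x x) ->
  (forall x y y', H x y -> H x y' -> lab x y = lab x y' -> y = y') ->
  exists c : T -> option L, forall x y, H x y -> c x <> c y.
Proof.
move=> Hsym Hirr Hlab.
pose proper (P : set (T * option L)) :=
  (forall x a a', P (x, a) -> P (x, a') -> a = a') /\
  (forall x y a, P (x, a) -> P (y, a) -> ~ H x y).
have [||P [_ [Pfun Pprop] Pmax]] := @Zorn_above _ proper set0.
- by split=> [? ? ? []|? ? ? []].
- move=> F _ Fp Ftot; split.
    move=> x a a' xa xa'; have [X [FX Xa Xa']] := chain_pair Ftot xa xa'.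
    exact: (Fp _ FX).1 Xa Xa'.
  move=> x y a xa ya; have [X [FX Xx Xy]] := chain_pair Ftot xa ya.
  exact: (Fp _ FX).2 Xx Xy.
suff /choice[c cP] : forall x, exists a, P (x, a).
  by exists c => x y Hxy cxy; apply: (Pprop x y (c x)) Hxy => //; rewrite cxy.
move=> x; apply: contrapT => nP.
have [[a afree]|nfree] := pselect (exists a, forall y, H x y -> ~ P (y, a)).
  have /(Pmax _ (@subsetUl _ _ _)) : proper (P `|` [set (x, a)]).
    split.
      move=> z b b' [Pb|[zE ->]] [Pb'|[zE' ->]] //.
      - exact: Pfun Pb Pb'.
      - by case: nP; exists b; rewrite -zE'.
      - by case: nP; exists b'; rewrite -zE.
    move=> z w b [Pz|[-> bE]] [Pw|[-> bE']].
    - exact: Pprop Pz Pw.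
    - by move=> /Hsym /afree; rewrite -bE'.
    - by move=> /afree; rewrite -bE.
    - exact: Hirr.
  by move=> /(_ (x, a)) Pxa; apply: nP; exists a; apply: Pxa; right.
have /choice[y yP] : forall a, exists y, H x y /\ P (y, a).
  move=> a; apply: contrapT => nex; apply: nfree; exists a => y Hy Py.
  by apply: nex; exists y.
have /leq_card : injective (fun a => lab x (y a)).
  move=> a b /Hlab yab; have [Ha Pa] := yP a; have [Hb Pb] := yP b.
  by apply: Pfun Pa _; rewrite yab.
by rewrite card_option ltnn.
Qed.

(** The vertices are coloured so that two points at distance at most two differ
    in colour; each point then has at most one neighbour of a given colour, and
    the edges between two given colours form a matching. *)
Lemma entourage_matchings {E : set (nat * nat)} : E_omega E ->
  exists Ms : seq (set (nat * nat)),
    (forall M, M \in Ms -> matching M) /\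
    forall x y, E (x, y) -> x <> y -> exists2 M, M \in Ms & M (x, y).
Proof.
move=> [Erefl [n En]].
pose adj x y := E (x, y) \/ E (y, x).
have adjxx x : adj x x by left; exact: Erefl.
have adjC x y : adj x y -> adj y x by case; [right|left].
have /choice[e eP] : forall x, exists f, inj_into (xsection E x `|` ysection E x) `I_n f.
  by move=> x; exact: card_le_inj_into 0 (En x).
have eI x y : adj x y -> e x y < n.
  move=> xy; apply: (eP x).1; case: xy => ?;
    by [left; exact/xsectionP|right; exact/ysectionP].
have einj x y y' : adj x y -> adj x y' -> e x y = e x y' -> y = y'.
  by move=> xy xy'; apply: (eP x).2; [case: xy => ?|case: xy' => ?];
     by [left; exact/xsectionP|right; exact/ysectionP].
pose H x y := x <> y /\ exists2 z, adj x z & adj z y.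
have /choice[mid midP] : forall p : nat * nat, exists z,
    H p.1 p.2 -> adj p.1 z /\ adj z p.2.
  move=> [x y]; have [[xy [z xz zy]]|nH] := pselect (H x y); first by exists z.
  by exists 0.
(* A path of length two is labelled by the labels of its two steps; labels lie
   in 'I_n.+1 only because that type is inhabited. *)
pose lab x y : 'I_n.+1 * 'I_n.+1 :=
  (inord (e x (mid (x, y))), inord (e (mid (x, y)) y)).
have inordK' x y : adj x y -> nat_of_ord (inord (e x y) : 'I_n.+1) = e x y.
  by move=> xy; rewrite inordK // ltnS ltnW // eI.
have [||x y y' Hy Hy'|c cP] := @bounded_degree_coloring _ _ H lab.
- by move=> x y [xy [z xz zy]]; split; [exact: nesym|exists z; exact: adjC].
- by move=> x [].
- have /= [xm my] := midP (x, y) Hy; have /= [xm' my'] := midP (x, y') Hy'.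
  case=> /(congr1 (@nat_of_ord _)) + /(congr1 (@nat_of_ord _)).
  rewrite !inordK' // => /einj mm; rewrite -mm // in my' *.
  exact: einj.
have cadj x y : adj x y -> x <> y -> c x <> c y.
  by move=> xy nxy; apply: cP; split=> //; exists y.
pose col := option ('I_n.+1 * 'I_n.+1)%type.
pose M (p : col * col) : set (nat * nat) := [set q |
  [/\ adj q.1 q.2, q.1 <> q.2 &
      (c q.1, c q.2) = p \/ (c q.2, c q.1) = p]].
exists (map M (enum {: col * col})); split; last first.
  move=> x y Exy xy; exists (M (c x, c y)); first by apply: map_f; rewrite mem_enum.
  by split=> //=; [left|left].
move=> _ /mapP[[a b] _ ->]; split=> [x y [/= xy nxy cxy]|x [] //|].
  by split=> /=; [exact: adjC|exact: nesym|case: cxy; [right|left]].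
move=> x y y' [/= xy nxy cxy] [/= xy' nxy' cxy'].
apply: contrapT => yy'.
have cyy' : c y <> c y' by apply: cP; split=> //; exists x => //; exact: adjC.
case: cxy cxy' => [[ax yb]|[ya xb]] [[ax' y'b]|[y'a xb']].
- by apply: cyy'; rewrite yb y'b.
- by apply: (cadj x y) => //; rewrite xb' yb.
- by apply: (cadj x y) => //; rewrite ax' ya.
- by apply: cyy'; rewrite ya y'a.
Qed.

(** * Families that handle every involution *)

Definition involution_family : set (set (set nat)) :=
  [set F | F `<=` infinite_subsets /\
    forall h, I_omega h -> exists2 A, F A & finite_set (h @` A `&` A)].

Definition discrete_family : set (set (set nat)) :=
  [set F | F `<=` infinite_subsets /\
    forall E, E_omega E -> exists2 A, F A & is_discrete E A].

Definition matched_in (M : set (nat * nat)) (A : set nat) : set nat :=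
  [set x | A x /\ exists2 y, A y & M (x, y)].

Lemma involution_family_matching {F : set (set nat)} {M : set (nat * nat)} :
  involution_family F -> matching M ->
  exists2 A, F A & finite_set (matched_in M A).
Proof.
move=> [_ FI] Mmatch; have [h [hI hM]] := matching_extends_to_involution Mmatch.
have [A FA Afin] := FI h hI; exists A => //.
apply: sub_finite_set Afin => x [Ax [y Ay Mxy]]; split=> //.
by exists y => //; rewrite -(hM x y Mxy) hI.1.
Qed.

(** The edges are the pairs [w 2m, w (2m+1)] of an increasing sequence [w]
    that visits each of the given sets at infinitely many values of [m]. *)
Lemma matching_meeting_countably_many {A : nat -> set nat} :
  (forall n, infinite_set (A n)) ->
  exists2 M, matching M & forall n, infinite_set (matched_in M (A n)).
Proof.
move=> Ainf.
(* Every [n] is [idx m] for infinitely many [m], such as the codes of the pairs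
   [(n, j)]; [w] will take its values at [2m] and [2m+1] in [A (idx m)]. *)
pose idx k : nat := (odflt (0, 0) (choice.unpickle k)).1.
have /choice[z zP] : forall p : nat * nat, exists z,
    A (idx p.1./2) z /\ p.2 < z.
  move=> [k b] /=; apply: contrapT => nex; apply: (Ainf (idx k./2)).
  apply: (@sub_finite_set _ _ `I_b.+1); last exact: finite_II.
  by move=> x Ax; rewrite /= ltnS leqNgt; apply/negP => bx; apply: nex; exists x.
pose w := fix w k := if k is k'.+1 then z (k, w k') else z (0, 0).
have wA k : A (idx k./2) (w k).
  by case: k => [|k]; [exact: (zP (0, 0)).1|exact: (zP (k.+1, w k)).1].
have wlt : {homo w : i j / i < j}.
  by apply: homo_ltn; [exact: ltn_trans|move=> k; exact: (zP (k.+1, w k)).2].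
have winj i j : w i = w j -> i = j.
  by move=> wij; case: (ltngtP i j) => // /wlt; rewrite wij ltnn.
(* [s] exchanges the two indices of each pair [2m, 2m+1]. *)
pose s k := if odd k then k.-1 else k.+1.
have sodd k : odd (s k) = ~~ odd k.
  by rewrite /s; case: k => [|k] //=; case E: (odd k); rewrite /= E.
have sK k : s (s k) = k.
  by rewrite {1}/s sodd /s; case: k => [|k] //=; case: (odd k).
have shalf k : (s k)./2 = k./2.
  rewrite /s; case: ifP => [|/negbT ek] /=; last by rewrite uphalf_half (negbTE ek).
  by case: k => //= k ok; rewrite uphalf_half (negbTE ok).
exists [set p | exists k, p = (w k, w (s k))].
  split.
  - by move=> _ _ [k [-> ->]]; exists (s k); rewrite sK.
  - move=> x [k [-> /winj sk]]; have := sodd k; rewrite -sk; by case: (odd k).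
  - by move=> _ _ _ [k [-> ->]] [k' [/winj <- ->]].
move=> n; apply/infiniteP.
apply: (@inj_into_card_le _ _ _ _ (fun j : nat => w (choice.pickle (n, j)).*2)).
have idxE (j : nat) : idx (choice.pickle (n, j)) = n by rewrite /idx choice.pickleK.
split=> [j _|i j _ _ /winj /double_inj /(pcan_inj choice.pickleK)[]//].
set k := (choice.pickle (n, j)).*2.
have kn : idx k./2 = n by rewrite doubleK.
split; first by rewrite -kn.
by exists (w (s k)); [rewrite -kn -shalf|exists k].
Qed.

(** A countable family is defeated by a single matching that has infinitely many
    edges inside each of its members. *)
Lemma involution_family_infinite {F : set (set nat)} :
  involution_family F -> infinite_set F.
Proof.
move=> Ffam /finite_set_countable/countable_injP[f finj].
have [A0 FA0 _] : exists2 A, F A & finite_set (matched_in set0 A).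
  by apply: involution_family_matching Ffam _; split=> [? ? []|? []|? ? ? []].
have /choice[A AP] : forall n, exists B, F B /\ forall X, F X -> f X = n -> B = X.
  move=> n; have [[X [FX fX]]|nX] := pselect (exists X, F X /\ f X = n).
    exists X; split=> // Y FY fY; apply: finj; rewrite ?inE //.
    by rewrite fX fY.
  by exists A0; split=> // X FX fX; case: nX; exists X.
have [M Mmatch Minf] := @matching_meeting_countably_many A (fun n => Ffam.1 _ (AP n).1).
have [X FX] := involution_family_matching Ffam Mmatch.
by rewrite -((AP (f X)).2 X FX erefl); exact: Minf.
Qed.

(** * Handling finitely many matchings at once *)

(** Composed in this order, each enumeration passes to a subset of the range
    already reached: the range for [A :: s] lies in that of [e A]. *)
Definition refinement (e : set nat -> nat -> nat) (s : seq (set nat)) :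
    nat -> nat :=
  foldr (fun A u => e A \o u) id s.

(** A first set handles the first matching. Transported along an enumeration of
    that set, the other matchings are matchings of [nat] again, so that they
    can be handled in turn. *)
Lemma refinement_matchings {F : set (set nat)} {e} : involution_family F ->
  (forall A, F A -> inj_into setT A (e A)) ->
  forall Ms : seq (set (nat * nat)), (forall M, M \in Ms -> matching M) ->
  exists s, (forall A, A \in s -> F A) /\
    forall M, M \in Ms -> finite_set (matched_in M (range (refinement e s))).
Proof.
move=> Ffam eP Ms; have [k] := ubnP (size Ms).
elim: k Ms => // k IHk [|M Ms] /= szMs Mmatch; first by exists [::].
have [A FA Afin] := involution_family_matching Ffam (Mmatch M (mem_head _ _)).
have [eA einj] := eP A FA.
pose pull (N : set (nat * nat)) : set (nat * nat) :=
  [set p | N (e A p.1, e A p.2)].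
have [|_ /mapP[N NMs ->]|s [sF sfin]] := IHk (map pull Ms).
- by rewrite size_map.
- have [|Nsym Nirr Nfun] := Mmatch N; first by rewrite inE NMs orbT.
  split=> [x y /Nsym//|x /Nirr//|x y y' /= Ny Ny'].
  exact/(einj _ _ I I)/(Nfun _ _ _ Ny Ny').
exists (A :: s); split=> [B|N].
  by rewrite inE => /predU1P[->//|/sF].
rewrite inE => /predU1P[->|NMs].
  apply: sub_finite_set Afin => _ [[n _ <-] [_ [m _ <-] Mnm]].
  by split; [exact: eA|exists (e A (refinement e s m)); [exact: eA|]].
apply: sub_finite_set (finite_image (e A) (sfin _ (map_f pull NMs))).
move=> _ [[n _ <-] [_ [m _ <-] Nnm]].
exists (refinement e s n) => //; split; first by exists n.
by exists (refinement e s m); first by exists m.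
Qed.

Lemma refinement_inj {F : set (set nat)} {e} :
  (forall A, F A -> inj_into setT A (e A)) ->
  forall s, (forall A, A \in s -> F A) -> injective (refinement e s).
Proof.
move=> eP; elim=> [|A s IHs] sF //= m n.
have [_ einj] := eP A (sF A (mem_head _ _)).
by move=> /(einj _ _ I I)/IHs; apply=> B Bs; apply: sF; rewrite inE Bs orbT.
Qed.

(** * The two minima *)

(** The entourage is the diagonal together with the graph of [h].  The fixed
    point of [h], if any, may lie in [h @` A `&` A] without being a witness
    against discreteness, which costs at most one element. *)
Lemma discrete_involution_family {F : set (set nat)} :
  discrete_family F -> involution_family F.
Proof.
move=> [Finf FE]; split=> // h [hK hfix].
pose E : set (nat * nat) := [set p | p.2 = p.1 \/ p.2 = h p.1].
have [|A FA Adisc] := FE E.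
  split=> [p pp|]; first by left; exact: esym.
  exists 2 => x.
  have -> : xsection E x `|` ysection E x = [set x; h x].
    apply/seteqP; split=> y.
      case=> [/xsectionP[]/= ->|/ysectionP[]/= ->]; rewrite ?hK;
        by [left|right].
    by case=> ->; left; apply/xsectionP; [left|right].
  apply: (@card_le_trans _ _ _ ((fun n => if n == 0 then x else h x) @` `I_2));
    last exact: card_image_le.
  by apply: subset_card_le => y [->|->]; [exists 0|exists 1].
exists A => //.
have [[x0 hx0]|nfix] := pselect (exists x, h x = x).
  apply: (@sub_finite_set _ _
    ([set x | A x /\ A `&` xsection E x <> [set x]] `|` [set x0])).
    move=> _ [[x Ax <-] Ahx]; have [hx|nhx] := pselect (h x = x).
      by right; apply: hfix; rewrite ?hx.
    left; split=> // AE; have : (A `&` xsection E (h x)) x.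
      by split=> //; apply/xsectionP; right; rewrite /= hK.
    by rewrite AE => xhx; apply: nhx; rewrite -xhx.
  by rewrite finite_setU; split; last exact: finite_set1.
apply: sub_finite_set Adisc => _ [[x Ax <-] Ahx].
split=> // AE; have : (A `&` xsection E (h x)) x.
  by split=> //; apply/xsectionP; right; rewrite /= hK.
by rewrite AE => xhx; apply: nfix; exists x; rewrite -xhx.
Qed.

Lemma involution_family_refines {F : set (set nat)} : involution_family F ->
  exists2 G, discrete_family G & G #<= F.
Proof.
move=> Ffam; have Finf := involution_family_infinite Ffam.
have /choice[e eP] (A : set nat) : exists f : nat -> nat, F A -> inj_into setT A f.
  have [FA|nFA] := pselect (F A); last by exists id.
  by have [f ?] := card_le_inj_into 0 (iffLR (infiniteP A) (Ffam.1 A FA)); exists f.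
pose seqs : set (seq (set nat)) := [set s | forall A, A \in s -> F A].
exists [set range (refinement e s) | s in seqs]; last first.
  exact: card_le_trans (card_image_le _ _) (infinite_seq_card_le Finf).
split=> [_ [s sF <-]|E Efin].
  apply/infiniteP; apply: (@inj_into_card_le _ _ _ _ (refinement e s)).
  by split=> [n _|m n _ _]; [exists n|exact: (refinement_inj eP)].
have [Ms [Mmatch EMs]] := entourage_matchings Efin.
have [s [sF sfin]] := refinement_matchings Ffam eP Ms Mmatch.
exists (range (refinement e s)); first by exists s.
set A := range _.
have : finite_set (\bigcup_(M in [set` Ms]) matched_in M A).
  by apply: bigcup_finite => [|M]; [exact: finite_seq|exact: sfin].
apply: sub_finite_set => x [Ax AEx]; apply: contrapT => nx; apply: AEx.
apply/seteqP; split=> [y [Ay /xsectionP Exy]|_ ->]; last first.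
  by split=> //; apply/xsectionP; exact: Efin.1.
apply: contrapT => yx; apply: nx.
have [M MMs Mxy] := EMs x y Exy (nesym yx).
by exists M => //; split=> //; exists y.
Qed.

Lemma min_card_cofinal {T : Type} {Phi Psi : set (set T)} :
  Psi `<=` Phi -> (forall A, Phi A -> exists2 B, Psi B & B #<= A) ->
  min_card Phi = min_card Psi.
Proof.
move=> PsiPhi PhiPsi; apply/seteqP; split=> X [A [PA minA XA]].
  have [B PsiB BA] := PhiPsi A PA; exists B; split=> //.
    by move=> B' /PsiPhi/minA; exact: card_le_trans.
  have AB : A #= B by rewrite card_eq_le BA minA //; exact: PsiPhi.
  exact: card_eq_trans XA AB.
exists A; split=> //; first exact: PsiPhi.
by move=> A' /PhiPsi[B /minA AB]; exact: card_le_trans.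
Qed.

Theorem theorem7p5 :
  Delta_hat =
  min_card [set F : set (set nat) |
    F `<=` infinite_subsets /\
    forall E, E_omega E -> exists2 A, F A & is_discrete E A].
Proof.
apply: (@min_card_cofinal _ involution_family discrete_family).
- by move=> F; exact: discrete_involution_family.
- by move=> F; exact: involution_family_refines.
Qed.
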